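(* Let $B$ be a commutative Bézout domain with good factorization and let $M_V$ be a model of $T_{B,V,div}$, i.e. a $B$-module $M$ expanded by the predicates $V_\delta(M)=Ma$ for $\delta=v(a)\in\Gamma(B)^+$, $a\in B\setminus\{0\}$. Let $\phi(\mathbf y)$ be a positive primitive (pp) $\mathcal L_{B,V}$-formula. Then there are a finite set $I$, a finite partition of $MSpec(B)$ into subsets $O_i$ ($i\in I$), each of which is a basic open or a basic closed subset, and for each $i\in I$ a conjunction $\theta_i(\mathbf y)$ of atomic $\mathcal L_{B_{\mathcal M},V}$-formulas (for $\mathcal M\in O_i$) such that for every tuple $\mathbf u$ of elements of $M$, $$M_V\models\phi(\mathbf u)\iff \bigwedge_{i\in I}\Big(\text{for all }\mathcal M\in O_i,\ (M_{\mathcal M})_V\models\theta_i(\mathbf u_{\mathcal M})\Big),$$ where $\mathbf u_{\mathcal M}$ denotes the image of the tuple $\mathbf u$ in the localization $M_{\mathcal M}$.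
   Context: Rings are commutative integral domains with $1$; $B$ is Bézout if every finitely generated ideal is principal. For $d\in B$, $rad(d)$ is the intersection of all maximal ideals of $B$ containing $d$. $B$ has good factorization if for all nonzero $a,b\in B$ there are $c,d\in B$ with $a=cd$, $\gcd(c,b)=1$ and $b\in rad(d)$. $Q(B)$ is the fraction field, $U$ the group of units of $B$, and $\Gamma(B)=Q(B)^\times/U$ the group of divisibility, (lattice-)ordered by $aU\le bU$ iff $ba^{-1}\in B$; its positive part is $\Gamma(B)^+=\{aU: a\in B\setminus\{0\}\}$, and $v(a)=aU$. $MSpec(B)$ is the set of maximal ideals of $B$; the basic closed sets are $V(a)=\{\mathcal M\in MSpec(B): a\in\mathcal M\}$, $a\in B$, and the basic open sets are their complements. For $\mathcal M\in MSpec(B)$, $B_{\mathcal M}$ is the localization (a valuation domain), $\Gamma(B_{\mathcal M})$ is its value group, $v_{\mathcal M}$ its valuation, and $\delta_{\mathcal M}$ is the image in $\Gamma(B_{\mathcal M})$ of $\delta\in\Gamma(B)$. $M_{\mathcal M}=M\otimes_B B_{\mathcal M}$ is the localization of $M$. For a Bézout domain $R$, $\mathcal L_R=\{+,-,0,\cdot a: a\in R\}$ is the language of $R$-modules and $\mathcal L_{R,V}=\mathcal L_R\cup\{V_\delta:\delta\in\Gamma(R)^+\}$ with unary predicates $V_\delta$. The theory $T_{R,V,div}$ consists of the theory of $R$-modules together with: (1) $V_\delta(0)$; (2) $V_{\delta_1}(m_1)\wedge V_{\delta_2}(m_2)\to V_{\delta_1\wedge\delta_2}(m_1+m_2)$;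 (3) $V_\delta(m)\to V_{\delta\wedge\mu}(m)$; (4) $V_\delta(m)\to V_{\delta\cdot v(a)}(ma)$ for $a\in R\setminus\{0\}$; (5) $\forall m\,V_1(m)$; (6) $V_{v(a)}(m)\to\exists n\,(na=m)$ for $a\in R\setminus\{0\}$ (for all $\delta,\delta_i,\mu\in\Gamma(R)^+$). Equivalently, a model is an $R$-module $N$ with $V_{v(a)}(N)=Na$ for every $a\in R\setminus\{0\}$. In $(M_{\mathcal M})_V$ the predicates are interpreted in this way for the $B_{\mathcal M}$-module $M_{\mathcal M}$: $V_\delta(M_{\mathcal M})=M_{\mathcal M}a$ whenever $\delta=v_{\mathcal M}(a)$. A pp formula is one of the form $\exists\mathbf x\,\theta(\mathbf x,\mathbf y)$ with $\theta$ a conjunction of atomic formulas. That $\theta_i$ is a single conjunction of atomic $\mathcal L_{B_{\mathcal M},V}$-formulas over $O_i$ means: its scalars are elements of $Q(B)$ that lie in $B_{\mathcal M}$ for every $\mathcal M\in O_i$, and its predicates are $V_\delta$ with $\delta\in\Gamma(B)$ such that $\delta_{\mathcal M}\in\Gamma(B_{\mathcal M})^+$ for every $\mathcal M\in O_i$, $V_\delta$ being read as $V_{\delta_{\mathcal M}}$ in $B_{\mathcal M}$-modules. *)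

(* Defs.v *)
From HB Require Import structures.
From mathcomp Require Import all_boot all_order all_algebra.
From mathcomp Require Import boolp classical_sets.
From mathcomp Require Import ring.

Set Implicit Arguments.
Unset Strict Implicit.
Unset Printing Implicit Defensive.

Import GRing.Theory.
Local Open Scope classical_set_scope.
Local Open Scope ring_scope.
Local Open Scope quotient_scope.

Notation "x %:F" := (@FracField.tofrac _ x).

Section BezoutDomains.
Variable B : idomainType.
Implicit Types (a b c d : B) (I J : set B).

Definition dvd a b := exists q, b = q * a.

Definition gcd_eq1 a b := forall e, dvd e a -> dvd e b -> dvd e 1.

Definition ideal_gen (s : seq B) : set B :=
  [set x | exists c : 'I_(size s) -> B, x = \sum_i c i * s`_i].

Definition bezout := forall s : seq B, exists d, ideal_gen s = ideal_gen [:: d].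

(* [idealr_closed] already requires the ideal to be proper. *)
Definition maximal_ideal I :=
  idealr_closed [in I] /\
  forall J, idealr_closed [in J] -> I `<=` J -> J = I.

Record MSpec := MaxIdeal {
  mset : set B;
  msetP : maximal_ideal mset
}.

Definition Vset a : set MSpec := [set P | mset P a].

Definition basic_closed (O : set MSpec) := exists a, O = Vset a.
Definition basic_open (O : set MSpec) := exists a, O = ~` Vset a.

Definition rad d : set B := \bigcap_(P in Vset d) mset P.

Definition good_factorization :=
  forall a b, a != 0 -> b != 0 ->
  exists c d, [/\ a = c * d, gcd_eq1 c b & rad d b].

End BezoutDomains.

(* The group of divisibility K^x / f(R^x), for f the embedding of R into its
   field of fractions K; its elements are the cosets a * f(R^x), as sets.  The
   field K is a parameter so that the groups of B and of its localizations are
   all made of cosets in the same field Q(B). *)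
Section Divisibility.
Variables (R : comNzRingType) (K : fieldType) (f : {rmorphism R -> K}).

Definition unit_group : set K :=
  [set f r | r in [set r : R | exists s, r * s = 1]].

Definition gcoset (a : K) : set K := [set a * u | u in unit_group].

Record gdiv := Gdiv {
  gset : set K;
  gsetP : exists2 a : K, a != 0 & gset = gcoset a
}.

Definition gle (g h : gdiv) :=
  exists a b : K, [/\ gset g a, gset h b & exists r : R, b * a^-1 = f r].

(* e is the meet of g and h *)
Definition gmeet (g h e : gdiv) :=
  [/\ gle e g, gle e h & forall k, gle k g -> gle k h -> gle k e].

Definition gpositive (g : gdiv) :=
  exists2 a : R, f a != 0 & gset g = gcoset (f a).

Record gpos := Gpos {
  gpos_gdiv :> gdiv;
  gposP : gpositive gpos_gdiv
}.

Definition v (a : K) (a0 : a != 0) : gdiv :=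
  @Gdiv (gcoset a) (ex_intro2 _ _ a a0 erefl).

Definition vpos (a : R) (a0 : f a != 0) : gpos :=
  @Gpos (v a0) (ex_intro2 _ _ a a0 erefl).

Lemma gcosetM a b :
  [set x * y | x in gcoset a & y in gcoset b] = gcoset (a * b).
Proof.
rewrite eqEsubset; split=> x /=.
- move=> [_ [_ [r [s rs] <-] <-]] [_ [_ [r' [s' rs'] <-] <-] <-].
  exists (f (r * r')); last by rewrite rmorphM mulrACA.
  by exists (r * r') => //; exists (s * s'); rewrite mulrACA rs rs' mulr1.
- move=> [u Uu <-]; exists (a * u); first by exists u.
  exists (b * 1); last by rewrite mulr1 mulrAC.
  by exists 1 => //; exists 1; [exists 1; rewrite mulr1 | rewrite rmorph1].
Qed.

Definition gmul_set (g h : gdiv) : set K := [set x * y | x in gset g & y in gset h].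

Lemma gmul_pos_subproof (g h : gpos) :
  exists2 a : R, f a != 0 & gmul_set g h = gcoset (f a).
Proof.
case: (gposP g) (gposP h) => a a0 ga [b b0 hb].
exists (a * b); first by rewrite rmorphM mulf_neq0.
by rewrite /gmul_set ga hb gcosetM rmorphM.
Qed.

Lemma gmul_subproof (g h : gpos) :
  exists2 a : K, a != 0 & gmul_set g h = gcoset a.
Proof. by have [a ? ?] := gmul_pos_subproof g h; exists (f a). Qed.

Definition gmul (g h : gpos) : gpos :=
  @Gpos (Gdiv (gmul_subproof g h)) (gmul_pos_subproof g h).

(* The predicates of N_V: V_delta(N) = N a whenever delta = v(a). *)
Definition Vcan (N : lmodType R) (delta : gpos) : set N :=
  [set n | exists a : R, [/\ f a != 0, gset delta = gcoset (f a)
                           & exists m : N, n = a *: m]].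

End Divisibility.

Notation Gamma B := (gdiv (@FracField.tofrac B)).
Notation GammaPos B := (gpos (@FracField.tofrac B)).

Section Models.
Variable B : idomainType.

Lemma tofrac_neq0 (a : B) : a != 0 -> a%:F != 0.
Proof. by rewrite tofrac_eq0. Qed.

Definition vB (a : B) (a0 : a != 0) : GammaPos B := vpos (tofrac_neq0 a0).

Record model_TVdiv (M : lmodType B) (V : GammaPos B -> set M) : Prop := {
  TV_zero : forall d, V d 0;
  TV_add : forall (d1 d2 e : GammaPos B), gmeet d1 d2 e ->
    forall m1 m2, V d1 m1 -> V d2 m2 -> V e (m1 + m2);
  TV_meet : forall (d mu e : GammaPos B), gmeet d mu e ->
    forall m, V d m -> V e m;
  TV_scale : forall (d : GammaPos B) (a : B) (a0 : a != 0) m,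
    V d m -> V (gmul d (vB a0)) (a *: m);
  TV_one : forall m, V (vB (oner_neq0 B)) m;
  TV_div : forall (a : B) (a0 : a != 0) m,
    V (vB a0) m -> exists n, a *: n = m
}.

Lemma gcoset_refl (R : comNzRingType) (K : fieldType)
  (f : {rmorphism R -> K}) (a : K) : gcoset f a a.
Proof.
by exists 1; [exists 1; [exists 1; rewrite mulr1|rewrite rmorph1]|rewrite mulr1].
Qed.

Lemma gpos_inj (R : comNzRingType) (K : fieldType) (f : {rmorphism R -> K})
  (g h : gpos f) : gset g = gset h -> g = h.
Proof.
case: g h => [[A pA] qA] [[C pC] qC] /= E; move: pA qA pC qC; rewrite E.
by move=> pA qA pC qC; rewrite (Prop_irrelevance pA pC) in qA *;
  rewrite (Prop_irrelevance qA qC).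
Qed.

Lemma gpos_vB (d : GammaPos B) : exists (a : B) (a0 : a != 0), d = vB a0.
Proof.
case: (gposP d) => a fa0 dE; have a0 : a != 0 by move: fa0; rewrite tofrac_eq0.
by exists a, a0; apply: gpos_inj.
Qed.

Lemma gle_vB a (a0 : a != 0) b (b0 : b != 0) :
  gle (vB a0) (vB b0) -> dvd a b.
Proof.
move=> [x [y [/= [_ [r [s rs] <-] <-] [_ [r' [s' rs'] <-] <-] [q]]]].
have r0 : r != 0.
  by apply/eqP=> r0; move/eqP: rs; rewrite r0 mul0r eq_sym oner_eq0.
move/(canRL (mulfVK _)); rewrite mulf_neq0 ?tofrac_eq0 // => /(_ isT) /eqP.
rewrite -!rmorphM tofrac_eq => /eqP E; exists (q * r * s').
by rewrite -[LHS]mulr1 -rs' mulrA E; ring.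
Qed.

Lemma Vcan_vB (M : lmodType B) a (a0 : a != 0) (n : M) :
  Vcan (vB a0) n <-> exists m : M, n = a *: m.
Proof.
split=> [[b [b0 E [m ->]]]|[m ->]]; last first.
  by exists a; split; [exact: tofrac_neq0| |exists m].
have [q ->] : dvd a b.
  rewrite tofrac_eq0 in b0; apply: (@gle_vB a a0 b b0).
  exists a%:F, a%:F; split; [exact: gcoset_refl| |].
    by rewrite /= -E; exact: gcoset_refl.
  by exists 1; rewrite divff ?rmorph1 ?tofrac_neq0.
by exists (q *: m); rewrite scalerA mulrC.
Qed.

Lemma model_TVdivP (M : lmodType B) (V : GammaPos B -> set M) :
  model_TVdiv V <->
  forall (a : B) (a0 : a != 0) m, V (vB a0) m <-> exists n, m = a *: n.
Proof.
split=> [[T0 TD TI TZ T1 Tdiv] a a0 m|VE].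
  split=> [/Tdiv[n <-]|[n ->]]; first by exists n.
  have := TZ _ a a0 _ (T1 n); congr (V _ _); apply: gpos_inj => /=.
  by rewrite /gmul_set /= gcosetM rmorph1 mul1r.
split.
- by move=> d; have [a [a0 ->]] := gpos_vB d; apply/VE; exists 0; rewrite scaler0.
- move=> d1 d2 e; have [a [a0 ->]] := gpos_vB d1; have [b [b0 ->]] := gpos_vB d2.
  have [c [c0 ->]] := gpos_vB e; move=> [/gle_vB[p Ea] /gle_vB[q Eb] _].
  move=> _ _ /VE[m1 ->] /VE[m2 ->]; apply/VE; rewrite Ea Eb; exists (p *: m1 + q *: m2).
  by rewrite scalerDr !scalerA ![c * _]mulrC.
- move=> d mu e; have [a [a0 ->]] := gpos_vB d; have [c [c0 ->]] := gpos_vB e.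
  move=> [/gle_vB[p Ea] _ _] _ /VE[m ->]; apply/VE; rewrite Ea; exists (p *: m).
  by rewrite scalerA mulrC.
- move=> d a a0 x; have [b [b0 ->]] := gpos_vB d => /VE[n ->].
  have ab0 : b * a != 0 by rewrite mulf_neq0.
  have -> : gmul (vB b0) (vB a0) = vB ab0.
    by apply: gpos_inj; rewrite /= /gmul_set /= gcosetM rmorphM.
  by apply/VE; exists n; rewrite scalerA mulrC.
- by move=> m; apply/VE; exists m; rewrite scale1r.
- by move=> a a0 m /VE[n ->]; exists n.
Qed.

End Models.

(* Terms and atomic formulas with scalars in S, predicates V_d indexed by
   d : D and variables in X.  A conjunction is a list of atomic formulas. *)
Inductive term (S X : Type) :=
| Tvar of X
| Tzero
| Tadd of term S X & term S X
| Topp of term S X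
| Tscale of S & term S X.
Arguments Tzero {S X}.

Inductive atom (S D X : Type) :=
| Aeq of term S X & term S X
| Apred of D & term S X.

Definition conj_atoms (S D X : Type) := seq (atom S D X).

(* exists x_0 .. x_{k-1}, theta (x, y): [inl] are the bound variables x and
   [inr] the free variables y. *)
Record pp_formula (S D : Type) (n : nat) := PP {
  pp_bound : nat;
  pp_matrix : conj_atoms S D ('I_pp_bound + 'I_n)
}.

Section Semantics.
Variables (R : pzRingType) (N : lmodType R) (D X : Type) (V : D -> set N).
Implicit Type e : X -> N.

Fixpoint eval e (t : term R X) : N :=
  match t with
  | Tvar x => e x
  | Tzero => 0
  | Tadd t1 t2 => eval e t1 + eval e t2
  | Topp t1 => - eval e t1
  | Tscale a t1 => a *: eval e t1
  end.

Definition sat_atom e (A : atom R D X) : Prop :=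
  match A with
  | Aeq t1 t2 => eval e t1 = eval e t2
  | Apred d t => V d (eval e t)
  end.

Fixpoint sat e (th : conj_atoms R D X) : Prop :=
  if th is A :: th' then sat_atom e A /\ sat e th' else True.

End Semantics.

Definition sat_pp (R : pzRingType) (N : lmodType R) (D : Type)
    (V : D -> set N) n (u : 'I_n -> N) (phi : pp_formula R D n) : Prop :=
  exists x : 'I_(pp_bound phi) -> N,
    sat V (fun z => match z with inl i => x i | inr j => u j end)
        (pp_matrix phi).

Section Translation.
Variables (S S' D D' X : Type) (fS : S -> S') (fD : D -> D').

Fixpoint map_term (t : term S X) : term S' X :=
  match t with
  | Tvar x => Tvar _ x
  | Tzero => Tzero
  | Tadd t1 t2 => Tadd (map_term t1) (map_term t2)
  | Topp t1 => Topp (map_term t1)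
  | Tscale a t1 => Tscale (fS a) (map_term t1)
  end.

Definition map_atom (A : atom S D X) : atom S' D' X :=
  match A with
  | Aeq t1 t2 => Aeq _ (map_term t1) (map_term t2)
  | Apred d t => Apred (fD d) (map_term t)
  end.

Definition map_conj (th : conj_atoms S D X) : conj_atoms S' D' X :=
  map map_atom th.

End Translation.

Section MaximalIdealTheory.
Variables (B : idomainType) (P : MSpec B).
Implicit Types a b s t : B.
Local Notation I := (mset P).

Lemma mset0 : I 0.
Proof. by case: (msetP P) => -[+ _ _] _; rewrite inE. Qed.

Lemma mset1 : ~ I 1.
Proof. by case: (msetP P) => -[_ /negP + _] _; rewrite inE. Qed.

Lemma msetDM a s t : I s -> I t -> I (a * s + t).
Proof.
case: (msetP P) => -[_ _ closI] _ Is It.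
by have := closI a s t; rewrite !inE; apply.
Qed.

Lemma mset_prime s t : I (s * t) -> I s \/ I t.
Proof.
move=> Ist; apply: contrapT => /not_orP[nIs nIt].
pose J : set B := [set x | exists a i, I i /\ x = a * s + i].
have IJ : I `<=` J by move=> i Ii; exists 0, i; rewrite mul0r add0r.
have Js : J s by exists 1, 0; split; [exact: mset0 | rewrite mul1r addr0].
have : J 1.
  apply: contrapT => nJ1; apply: nIs.
  have [_ maxI] := msetP P; rewrite -(maxI J) //; split.
  - by rewrite inE; apply: IJ; exact: mset0.
  - by apply/negP; rewrite inE.
  - move=> a x y; rewrite !inE => -[b [i [Ii ->]]] [c [j [Ij ->]]].
    exists (a * b + c), (a * i + j); split; first exact: msetDM.
    by rewrite mulrDr mulrDl !mulrA addrACA.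
move=> [a [i [Ii def1]]]; apply: nIt.
have := msetDM a Ist (msetDM t Ii mset0).
by rewrite addr0 mulrA [t * i]mulrC -mulrDl -def1 mul1r.
Qed.

Lemma mset_neq0 s : ~ I s -> s != 0.
Proof. by move=> nIs; apply/eqP=> s0; apply: nIs; rewrite s0; exact: mset0. Qed.

End MaximalIdealTheory.

Section LocalRing.
Variables (B : idomainType) (P : MSpec B).
Implicit Types (a s t : B).

Definition locset : set {fraction B} :=
  [set x | exists a s, ~ mset P s /\ x = a%:F / s%:F].

Record locring := Locring {
  lrval : {fraction B};
  lrvalP : lrval \in locset
}.

HB.instance Definition _ := [isSub for lrval].
HB.instance Definition _ := [Choice of locring by <:].

Lemma locset_subring : subring_closed [in locset].
Proof.
split=> [|x y|x y]; rewrite !inE.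
- exists 1, 1; split; first exact: mset1.
  by rewrite rmorph1 divr1.
- move=> [a [s [nIs ->]]] [b [t [nIt ->]]].
  exists (a * t - b * s), (s * t); split; first by case/mset_prime.
  rewrite -mulNr -!rmorphN addf_div ?tofrac_neq0 ?(mset_neq0 nIs) ?(mset_neq0 nIt) //.
  by rewrite -!rmorphM -rmorphD mulNr.
- move=> [a [s [nIs ->]]] [b [t [nIt ->]]].
  exists (a * b), (s * t); split; first by case/mset_prime.
  by rewrite !rmorphM invfM mulrACA.
Qed.

HB.instance Definition _ :=
  GRing.SubChoice_isSubComNzRing.Build {fraction B} [in locset] locring
    locset_subring.

Definition locval : {rmorphism locring -> {fraction B}} := \val.

Record denom := Denom {
  dval : B;
  dvalP : dval \notin mset P
}.

HB.instance Definition _ := [isSub for dval].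
HB.instance Definition _ := [Choice of denom by <:].

Lemma locset_frac a (s : denom) : a%:F / (dval s)%:F \in locset.
Proof.
by rewrite inE; exists a, (dval s); split=> //; move: (valP s) => /negP; rewrite inE.
Qed.

Definition rfrac a (s : denom) : locring := Locring (locset_frac a s).

Lemma rfracP (x : locring) : exists as_ : B * denom, x = rfrac as_.1 as_.2.
Proof.
case: x => x xP; have /set_mem[a [s [nIs xE]]] := xP.
have Ps : s \notin mset P by apply/negP; rewrite inE.
by exists (a, Denom Ps); apply: val_inj.
Qed.

Definition rnum (x : locring) : B := (sval (cid (rfracP x))).1.
Definition rden (x : locring) : denom := (sval (cid (rfracP x))).2.

Lemma rfracK x : rfrac (rnum x) (rden x) = x.
Proof. by rewrite /rnum /rden; case: cid. Qed.

Lemma denomP (s : denom) : ~ mset P (dval s).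
Proof. by move: (valP s) => /negP; rewrite inE. Qed.

Lemma denom_neq0 (s : denom) : dval s != 0.
Proof. exact: mset_neq0 (@denomP s). Qed.

Lemma denomM_subproof (s t : denom) : dval s * dval t \notin mset P.
Proof.
apply/negP; rewrite inE => /mset_prime[]; exact: denomP.
Qed.
Definition denomM (s t : denom) : denom := Denom (denomM_subproof s t).

Lemma denom1_subproof : (1 : B) \notin mset P.
Proof. by apply/negP; rewrite inE; exact: mset1. Qed.
Definition denom1 : denom := Denom denom1_subproof.

Lemma rfrac_eq a (s : denom) b (t : denom) : rfrac a s = rfrac b t <-> a * dval t = b * dval s.
Proof.
have s0 := tofrac_neq0 (denom_neq0 s); have t0 := tofrac_neq0 (denom_neq0 t).
split=> [/(congr1 val)/eqP|E].
  by rewrite /= eqr_div // -!rmorphM tofrac_eq => /eqP.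
by apply/val_inj/eqP; rewrite /= eqr_div // -!rmorphM tofrac_eq E.
Qed.

Lemma rfracD a (s : denom) b (t : denom) :
  rfrac a s + rfrac b t = rfrac (a * dval t + b * dval s) (denomM s t).
Proof.
have s0 := tofrac_neq0 (denom_neq0 s); have t0 := tofrac_neq0 (denom_neq0 t).
by apply: val_inj; rewrite rmorphD /= addf_div // rmorphD !rmorphM.
Qed.

Lemma rfracM a (s : denom) b (t : denom) : rfrac a s * rfrac b t = rfrac (a * b) (denomM s t).
Proof. by apply: val_inj; rewrite rmorphM /= !rmorphM invfM mulrACA. Qed.

Lemma rfrac1 : rfrac 1 denom1 = 1.
Proof. by apply: val_inj; rewrite /= rmorph1 divr1. Qed.

End LocalRing.

(* M_P as the module of fractions m/s with s outside P; see [locmod_tensor]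
   for its identification with the tensor product of M and B_P over B. *)
Section LocalModule.
Variables (B : idomainType) (M : lmodType B) (P : MSpec B).
Implicit Types (m n : M) (s t : denom P).
Local Notation dom := (M * denom P)%type.

Definition equivl (x y : dom) : bool :=
  `[< exists u : denom P,
        dval u *: (dval y.2 *: x.1) = dval u *: (dval x.2 *: y.1) >].

Lemma equivl_refl : reflexive equivl.
Proof. by move=> x; apply/asboolP; exists (denom1 P). Qed.

Lemma equivl_sym : symmetric equivl.
Proof. by move=> x y; apply/asboolP/asboolP => -[u E]; exists u. Qed.

Lemma equivl_trans : transitive equivl.
Proof.
move=> [n t] [m s] [p r] /asboolP[u /= E] /asboolP[w /= F].
apply/asboolP; exists (denomM t (denomM u w)) => /=.
transitivity ((dval w * dval r) *: (dval u *: (dval t *: m))).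
  by rewrite !scalerA; congr (_ *: _); ring.
rewrite E; transitivity ((dval u * dval s) *: (dval w *: (dval r *: n))).
  by rewrite !scalerA; congr (_ *: _); ring.
by rewrite F !scalerA; congr (_ *: _); ring.
Qed.

Canonical equivl_equiv := EquivRel equivl equivl_refl equivl_sym equivl_trans.

Definition locmod := {eq_quot equivl}.

HB.instance Definition _ : EqQuotient _ equivl locmod := EqQuotient.on locmod.
HB.instance Definition _ := Choice.on locmod.

Definition mfrac m s : locmod := \pi_locmod (m, s).

Lemma mfrac_eq m s n t :
  mfrac m s = mfrac n t <->
  exists u : denom P, dval u *: (dval t *: m) = dval u *: (dval s *: n).
Proof.
split=> [/eqquotP/asboolP //|E]; exact/eqquotP/asboolP.
Qed.

Lemma mfracW (T : locmod -> Prop) : (forall m s, T (mfrac m s)) -> forall x, T x.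
Proof. by move=> TH; elim/quotW=> -[m s]; exact: TH. Qed.

Definition mnum (x : locmod) : M := (repr x).1.
Definition mden (x : locmod) : denom P := (repr x).2.

Lemma mfracK x : mfrac (mnum x) (mden x) = x.
Proof. by rewrite /mfrac -surjective_pairing reprK. Qed.

Lemma mnum_mden m s : exists u : denom P,
  dval u *: (dval s *: mnum (mfrac m s)) = dval u *: (dval (mden (mfrac m s)) *: m).
Proof. by apply/mfrac_eq; rewrite mfracK. Qed.

Definition locadd (x y : locmod) : locmod :=
  mfrac (dval (mden y) *: mnum x + dval (mden x) *: mnum y)
        (denomM (mden x) (mden y)).
Definition locopp (x : locmod) : locmod := mfrac (- mnum x) (mden x).
Definition loczero : locmod := mfrac 0 (denom1 P).
Definition locscale (a : locring P) (x : locmod) : locmod :=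
  mfrac (rnum a *: mnum x) (denomM (rden a) (mden x)).

Lemma locaddE m s n t :
  locadd (mfrac m s) (mfrac n t)
  = mfrac (dval t *: m + dval s *: n) (denomM s t).
Proof.
have [u Eu] := mnum_mden m s; have [w Ew] := mnum_mden n t.
apply/mfrac_eq; exists (denomM u w) => /=.
set s' := mden _ in Eu *; set m' := mnum _ in Eu *.
set t' := mden _ in Ew *; set n' := mnum _ in Ew *.
rewrite !scalerDr; congr (_ + _).
  transitivity ((dval w * dval t * dval t') *: (dval u *: (dval s *: m'))).
    by rewrite !scalerA; congr (_ *: _); ring.
  by rewrite Eu !scalerA; congr (_ *: _); ring.
transitivity ((dval u * dval s * dval s') *: (dval w *: (dval t *: n'))).
  by rewrite !scalerA; congr (_ *: _); ring.
by rewrite Ew !scalerA; congr (_ *: _); ring.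
Qed.

Lemma locoppE m s : locopp (mfrac m s) = mfrac (- m) s.
Proof.
have [u Eu] := mnum_mden m s; apply/mfrac_eq; exists u.
by rewrite !scalerN Eu.
Qed.

Lemma locscaleE a r m s :
  locscale (rfrac a r) (mfrac m s) = mfrac (a *: m) (denomM r s).
Proof.
have [u Eu] := mnum_mden m s; apply/mfrac_eq; exists u => /=.
have /rfrac_eq Er := rfracK (rfrac a r).
set s' := mden _ in Eu *; set m' := mnum _ in Eu *.
transitivity ((rnum (rfrac a r) * dval r) *: (dval u *: (dval s *: m'))).
  by rewrite !scalerA; congr (_ *: _); ring.
by rewrite Er Eu !scalerA; congr (_ *: _); ring.
Qed.

Lemma eq_mfrac m s n t : dval t *: m = dval s *: n -> mfrac m s = mfrac n t.
Proof. by move=> E; apply/mfrac_eq; exists (denom1 P); rewrite E. Qed.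

Lemma locaddA : associative locadd.
Proof.
elim/mfracW=> m s; elim/mfracW=> n t; elim/mfracW=> p r.
rewrite !locaddE; apply: eq_mfrac => /=; rewrite !scalerDr !scalerA -!addrA.
by congr (_ *: _ + (_ *: _ + _ *: _)); ring.
Qed.

Lemma locaddC : commutative locadd.
Proof.
elim/mfracW=> m s; elim/mfracW=> n t; rewrite !locaddE.
by apply: eq_mfrac => /=; rewrite addrC [dval s * _]mulrC.
Qed.

Lemma locadd0 : left_id loczero locadd.
Proof.
elim/mfracW=> m s; rewrite locaddE; apply: eq_mfrac => /=.
by rewrite scaler0 add0r scale1r mul1r.
Qed.

Lemma locaddN : left_inverse loczero locopp locadd.
Proof.
elim/mfracW=> m s; rewrite locoppE locaddE; apply: eq_mfrac => /=.
by rewrite scalerN addNr !scaler0.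
Qed.

HB.instance Definition _ :=
  GRing.isZmodule.Build locmod locaddA locaddC locadd0 locaddN.

Lemma mfracD m s n t :
  mfrac m s + mfrac n t = mfrac (dval t *: m + dval s *: n) (denomM s t).
Proof. exact: locaddE. Qed.

Lemma locscaleA a b x : locscale a (locscale b x) = locscale (a * b) x.
Proof.
rewrite -(rfracK a) -(rfracK b); elim/mfracW: x => m s.
rewrite rfracM !locscaleE; apply: eq_mfrac => /=.
by rewrite !scalerA; congr (_ *: _); ring.
Qed.

Lemma locscale1 : left_id 1 locscale.
Proof.
elim/mfracW=> m s; rewrite -rfrac1 locscaleE; apply: eq_mfrac => /=.
by rewrite scale1r mul1r.
Qed.

Lemma locscaleDr : right_distributive locscale +%R.
Proof.
move=> a; rewrite -(rfracK a); elim/mfracW=> m s; elim/mfracW=> n t.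
rewrite mfracD !locscaleE mfracD; apply: eq_mfrac => /=.
rewrite !scalerDr !scalerA.
by congr (_ *: _ + _ *: _); ring.
Qed.

Lemma locscaleDl x : {morph locscale^~ x : a b / a + b}.
Proof.
move=> a b; rewrite -(rfracK a) -(rfracK b); elim/mfracW: x => m s.
rewrite rfracD !locscaleE mfracD; apply: eq_mfrac => /=.
rewrite !scalerA -!scalerDl !scalerA.
by congr (_ *: _); ring.
Qed.

HB.instance Definition _ :=
  GRing.Zmodule_isLmodule.Build (locring P) locmod
    locscaleA locscale1 locscaleDr locscaleDl.

Lemma mfracZ a r m s : rfrac a r *: mfrac m s = mfrac (a *: m) (denomM r s).
Proof. exact: locscaleE. Qed.

Definition toloc m : locmod := mfrac m (denom1 P).

(* Universal property of the tensor product, with m (x) r given by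
   r *: toloc m. *)
Lemma locmod_tensor (N : zmodType) (g : M -> locring P -> N) :
  (forall m n x, g (m + n) x = g m x + g n x) ->
  (forall m x y, g m (x + y) = g m x + g m y) ->
  (forall b m x, g (b *: m) x = g m (rfrac b (denom1 P) * x)) ->
  exists! h : locmod -> N,
    {morph h : x y / x + y} /\ forall m x, h (x *: toloc m) = g m x.
Proof.
move=> gDl gDr gB.
pose h (x : locmod) := g (mnum x) (rfrac 1 (mden x)).
have gE b m s a : g (b *: m) (rfrac a s) = g m (rfrac (b * a) s).
  rewrite gB rfracM; congr (g m _); apply/rfrac_eq => /=; ring.
have hE m s : h (mfrac m s) = g m (rfrac 1 s).
  have [u Eu] := mnum_mden m s; rewrite /h.
  set s' := mden _ in Eu *; set m' := mnum _ in Eu *.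
  have -> : rfrac 1 s' = rfrac (dval u * dval s * 1) (denomM u (denomM s s')).
    by apply/rfrac_eq => /=; ring.
  have -> : rfrac 1 s = rfrac (dval u * dval s' * 1) (denomM u (denomM s s')).
    by apply/rfrac_eq => /=; ring.
  by rewrite -!gE -!scalerA Eu.
exists h; split.
  split=> [|m x].
    elim/mfracW=> m s; elim/mfracW=> n t; rewrite mfracD !hE gDl !gE.
    by congr (g _ _ + g _ _); apply/rfrac_eq => /=; ring.
  rewrite -{1}(rfracK x) mfracZ hE gE -[x in RHS]rfracK.
  by congr (g m _); apply/rfrac_eq => /=; ring.
move=> h' [_ h'E]; apply/funext; elim/mfracW=> m s; rewrite hE -h'E mfracZ.
by congr h'; apply: eq_mfrac; rewrite /= mulr1 scale1r.
Qed.

End LocalModule.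

Arguments toloc {B M} P m.

Section LocalGamma.
Variables (B : idomainType) (P : MSpec B).

Notation GammaLoc := (gdiv (locval P)).

Lemma gloc_subproof (g : Gamma B) :
  exists2 a : {fraction B}, a != 0 &
    [set x * u | x in gset g & u in unit_group (locval P)] = gcoset (locval P) a.
Proof.
case: (gsetP g) => a a0 ->; exists a => //; rewrite eqEsubset; split=> x /=.
- move=> [_ [_ [r [s rs] <-] <-]] [_ [y [z yz] <-] <-].
  exists (locval P (rfrac r (denom1 P) * y)); last first.
    by rewrite rmorphM /= rmorph1 divr1 mulrA.
  exists (rfrac r (denom1 P) * y) => //; exists (rfrac s (denom1 P) * z).
  rewrite mulrACA yz mulr1 rfracM rs -rfrac1; apply/rfrac_eq => /=; ring.
- move=> [u Uu <-]; exists a; last by exists u.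
  by exists 1; [exists 1; [exists 1; rewrite mulr1 | rewrite rmorph1]
               | rewrite mulr1].
Qed.

(* delta_P, the coset generated by delta *)
Definition gloc (g : Gamma B) : GammaLoc := Gdiv (gloc_subproof g).

End LocalGamma.

Notation GammaLocPos P := (gpos (locval P)).

Section LanguageOver.
Variables (B : idomainType) (O : set (MSpec B)).

(* Scalars and predicate symbols that make sense over every P in O. *)
Definition scal_over := {x : {fraction B} | forall P, O P -> x \in locset P}.

Definition gamma_over :=
  {g : Gamma B | forall P, O P -> gpositive (gloc P g)}.

Definition conj_over (n : nat) := conj_atoms scal_over gamma_over 'I_n.

Variables (P : MSpec B) (OP : O P).

Definition scal_at (x : scal_over) : locring P :=
  Locring (svalP x P OP).

Definition gamma_at (g : gamma_over) : GammaLocPos P := Gpos (svalP g P OP).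

Definition formula_at n (th : conj_over n) :
    conj_atoms (locring P) (GammaLocPos P) 'I_n :=
  map_conj scal_at gamma_at th.

End LanguageOver.

(* Main.v *)
(* Good factorization makes B an adequate ring, so Helmer's argument applies:
   every nonzero matrix A over B can be written g A1 with p A1 q = 1 for some
   row p and column q.  Then A x = t is solvable iff g divides p t and
   (A - A q p A1) x = t - A1 q p t is solvable, and the new matrix has smaller
   rank.  Hence, already over B, every pp formula is equivalent to a conjunction
   of divisibility conditions on linear forms in the free variables.  Such
   conditions are local-global, so the one-block partition MSpec(B) = V(0)
   suffices. *)
Require Import Defs.
From HB Require Import structures.
From mathcomp Require Import all_boot all_order all_algebra.
From mathcomp Require Import boolp classical_sets.
From mathcomp Require Import ring.

Set Implicit Arguments.
Unset Strict Implicit.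
Unset Printing Implicit Defensive.

Import GRing.Theory.
Local Open Scope classical_set_scope.
Local Open Scope ring_scope.

Local Notation dvd := Defs.dvd.

(** * Maximal ideals, comaximal pairs and adequacy *)

Section Comaximality.
Variable B : idomainType.
Implicit Types (a b c : B) (J : set B).

(** Zorn's lemma is applied to the sets X whose union with [J] is a proper ideal, so that the empty
    chain, whose union is empty, is covered by [J] itself. *)
Lemma krull J : idealr_closed [in J] -> exists P : MSpec B, J `<=` mset P.
Proof.
move=> idJ; pose Q (X : set B) := idealr_closed [in J `|` X].
have [|I [QI maxI]] := @Zorn_bigcup B Q.
  move=> F FQ chainF; case: (idJ) => J0 J1 Jc; split.
  - by rewrite inE; left; rewrite inE in J0.
  - apply/negP; rewrite inE => -[/mem_set|[X FX X1]]; first exact/negP.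
    by case: (FQ _ FX) => _ /negP + _; apply; rewrite inE; right.
  - have inQ X x : F X -> (J `|` X) x -> (J `|` \bigcup_(X in F) X) x.
      by move=> FX [Jx|Xx]; [left | right; exists X].
    have both x y : (J `|` \bigcup_(X in F) X) x ->
      (J `|` \bigcup_(X in F) X) y ->
        (J x /\ J y) \/ exists2 X, F X & (J `|` X) x /\ (J `|` X) y.
      move=> [Jx|[X FX Xx]] [Jy|[Y FY Yy]].
      + by left.
      + by right; exists Y => //; split; [left|right].
      + by right; exists X => //; split; [right|left].
      + right; have [XY|YX] := chainF _ _ FX FY.
          by exists Y => //; split; right => //; apply: XY.
        by exists X => //; split; right => //; apply: YX.
    move=> a x y; rewrite !inE => Ux Uy; have [[Jx Jy]|[X FX [Xx Xy]]] :=
      both _ _ Ux Uy.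
      by left; have := Jc a x y; rewrite !inE; apply.
    apply: (inQ X) => //; case: (FQ _ FX) => _ _ Xc.
    by have := Xc a x y; rewrite !inE; apply.
have mI : maximal_ideal (J `|` I).
  split=> // K idK IK; rewrite eqEsubset; split=> //.
  apply: contrapT => nKI; have IltK : I `<` K.
    split; first by move=> x Ix; apply: IK; right.
    by move=> KI; apply: nKI => x Kx; right; apply: KI.
  apply: (maxI _ IltK); rewrite /Q; suff -> : J `|` K = K by [].
  by apply/setUidPr => x Jx; apply: IK; left.
by exists (MaxIdeal mI) => x Jx; left.
Qed.

(** If 1 were not a combination of [a] and [b], [krull] would place the ideal they generate inside a
    maximal ideal containing both. *)
Lemma comaximal a b : (forall P : MSpec B, mset P a -> ~ mset P b) ->
  exists s t, s * a + t * b = 1.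
Proof.
move=> ab; pose J : set B := [set x | exists s t, s * a + t * b = x].
apply: contrapT => nJ1; have [|P JP] := @krull J.
  split; [| |move=> r x y]; rewrite ?inE.
  - by exists 0, 0; rewrite !mul0r addr0.
  - by apply/negP; rewrite inE.
  - move=> [s [t <-]] [s' [t' <-]]; exists (r * s + s'), (r * t + t'); ring.
apply: (ab P); apply: JP.
  by exists 1, 0; rewrite mul1r mul0r addr0.
by exists 0, 1; rewrite mul1r mul0r add0r.
Qed.

Lemma msetM (P : MSpec B) a b : mset P a -> mset P (b * a).
Proof. by move=> Pa; rewrite -[_ * _]addr0; apply/msetDM/mset0. Qed.

Lemma mset_lin2 (P : MSpec B) s t a b :
  mset P a -> mset P b -> mset P (s * a + t * b).
Proof. by move=> Pa Pb; apply/msetDM/msetM. Qed.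

Hypothesis hbez : bezout B.

Lemma bezout2 a b : exists d u w, [/\ u * a + w * b = d, dvd d a & dvd d b].
Proof.
have [d dE] := hbez [:: a; b].
have gen1 x : ideal_gen [:: d] x -> dvd d x.
  by move=> [c ->]; rewrite big_ord1 /=; exists (c ord0).
have : ideal_gen [:: d] d by exists (fun=> 1); rewrite big_ord1 mul1r.
rewrite -dE => -[c]; rewrite /= !big_ord_recl big_ord0 addr0 /= => cE.
exists d, (c ord0), (c (lift ord0 ord0)); split=> //; apply: gen1; rewrite -dE.
  exists (fun i => (i == ord0)%:R); rewrite /= !big_ord_recl big_ord0 /=.
  by rewrite mul1r mul0r !addr0.
exists (fun i => (i != ord0)%:R); rewrite /= !big_ord_recl big_ord0 /=.
by rewrite mul1r mul0r add0r addr0.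
Qed.

Lemma bezout_fin (I : finType) (f : I -> B) :
  exists d (c : I -> B), \sum_i c i * f i = d /\ forall i, dvd d (f i).
Proof.
suff H (s : seq I) :
    exists d, (exists c : I -> B, \sum_i c i * f i = d) /\ forall i, i \in s ->
      dvd d (f i).
  have [d [[c cd] dv]] := H (enum I); exists d, c.
  by split=> // i; apply: dv; rewrite mem_enum.
elim: s => [|j s [d [[c cd] dv]]].
  by exists 0; split=> //; exists (fun=> 0); rewrite big1 // => i _;
    rewrite mul0r.
have [e [u [w [<- [q qd] ef]]]] := bezout2 d (f j).
exists (u * d + w * f j); split.
  exists (fun i => u * c i + w * (i == j)%:R).
  under eq_bigr do rewrite mulrDl -!mulrA.
  rewrite big_split /= -!mulr_sumr cd (bigD1 j) //= eqxx mul1r big1 ?addr0 //.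
  by move=> i /negPf->; rewrite mul0r.
move=> i; rewrite inE => /orP[/eqP-> //|/dv[r rd]].
by exists (r * q); rewrite rd {1}qd mulrA.
Qed.

(** A Bézout gcd is a linear combination, so a maximal ideal containing [a] and [b] would contain a
    unit. *)
Lemma gcd_eq1_comax a b (P : MSpec B) : gcd_eq1 a b -> mset P a -> ~ mset P b.
Proof.
move=> ab Pa Pb; have [d [u [w [ud da db]]]] := bezout2 a b.
have [q q1] := ab d da db; apply: (@mset1 _ P); rewrite q1 -ud.
exact/msetM/mset_lin2.
Qed.

Hypothesis hgood : good_factorization B.

(* If c = r s with r prime to a and V(s) contained in V(a), then a + r b and
   r c have no common maximal ideal: one containing r would avoid a, and one
   containing s would contain a and c, hence b. *)
Lemma adequate_comax a b c x y z : x * a + y * b + z * c = 1 ->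
  exists p q s t, s * (p * a + q * b) + t * (q * c) = 1.
Proof.
(* Good factorization needs [c] and [a] nonzero. For [c] = 0 the given relation already has the
   required form; for [a] = 0 take [p] = 0 and [q] = 1. *)
move=> E; have [c0|c0] := eqVneq c 0.
  by exists x, y, 1, 0; rewrite mul1r mul0r addr0 -E c0 mulr0 addr0.
have [a0|a0] := eqVneq a 0.
  by exists 0, 1, y, z; rewrite mul0r add0r !mul1r -E a0 mulr0 add0r.
have [r [s [cE ra as_]]] := hgood c0 a0; exists 1, r; apply: comaximal => P.
rewrite mul1r => P1 P2.
have nPr : ~ mset P r.
  move=> Pr; apply: (gcd_eq1_comax ra Pr).
  by rewrite (_ : a = - b * r + (a + r * b)); [apply: msetDM|ring].
have Ps : mset P s.
  by case: (mset_prime P2) => // /[!cE] /mset_prime[].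
have Pa : mset P a by apply: as_.
have Pb : mset P b.
  have /mset_prime[] // : mset P (r * b).
  by rewrite (_ : r * b = -1 * a + (a + r * b)); [apply: msetDM|ring].
apply: (@mset1 _ P); rewrite -E -[x * a + _]mul1r; apply: mset_lin2.
  exact: mset_lin2.
by rewrite cE; exact: msetM.
Qed.

End Comaximality.

(** * Extracting a scalar factor that leaves a matrix representing 1 *)

Section Corner.
Variable B : idomainType.
Hypotheses (hbez : bezout B) (hgood : good_factorization B).

Lemma bezout3 (a b c : B) : exists d a' b' c',
  [/\ a = a' * d, b = b' * d, c = c' * d &
      exists x y z, x * a + y * b + z * c = d].
Proof.
have [e [u [w [eE [qb bE] [qc cE]]]]] := bezout2 hbez b c.
have [d [u' [w' [dE [qa aE] [qe eE']]]]] := bezout2 hbez a e.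
exists d, qa, (qb * qe), (qc * qe); split.
- exact: aE.
- by rewrite -mulrA -eE'.
- by rewrite -mulrA -eE'.
exists u', (w' * u), (w' * w); rewrite -dE -eE; ring.
Qed.

(** [c] is a gcd of the entries and [r] lists its Bézout coefficients. The product taken is r a, not
    r a1, because [a1] is arbitrary when [c] = 0. *)
Lemma content_cV m (a : 'cV[B]_m) : exists c (a1 : 'cV[B]_m) (r : 'rV[B]_m),
  a = c *: a1 /\ r *m a = c%:M.
Proof.
have [c [r [rE /choice[y yE]]]] := bezout_fin hbez (fun i => a i 0).
exists c, (\col_i y i), (\row_i r i); split.
  by apply/matrixP=> i j; rewrite !mxE ord1 yE mulrC.
rewrite [LHS]mx11_scalar mxE -rE; congr (_%:M).
by apply: eq_bigr => i _; rewrite mxE.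
Qed.

(* [g] is a gcd of the columns treated so far and [w] is unimodular.  A new
   column is a = b w + c a1, where b = p a and p kills c a1, so x (A q) + y a is
   (x g + y b) w + y c a1, and [adequate_comax] makes it a gcd times a
   unimodular column. *)
Lemma unimodular_column_span m n (A : 'M[B]_(m.+1, n)) (s : seq 'I_n) :
  exists g (w : 'cV_m.+1) (q : 'cV_n) (p : 'rV_m.+1),
    [/\ A *m q = g *: w, p *m w = 1%:M &
        forall j, j \in s -> exists v, col j A = g *: v].
Proof.
elim: s => [|j s [g [w [q [p [Aq pw dvs]]]]]].
  (* With no column treated the gcd is 0 and [w] can be any unimodular column; one exists because
     there is at least one row. *)
  exists 0, (delta_mx 0 0), 0, (delta_mx 0 0); split=> //.
    by rewrite mulmx0 scale0r.
  rewrite mul_delta_mx [LHS]mx11_scalar mxE; congr (_%:M).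
set a := col j A; set b := (p *m a) 0 0.
have pa : p *m a = b%:M by rewrite [LHS]mx11_scalar.
have [c [a1 [r [aE rE]]]] := content_cV (a - b *: w).
have [d [g' [b' [c' [gd bd cd [x [y [z lin]]]]]]]] := bezout3 g b c.
have aE' : a = b *: w + c *: a1 by rewrite -aE addrC subrK.
(* If [d] = 0 then [g], [b] and [c] vanish: the new column is 0 and the old data still serve. *)
have [d0|d0] := eqVneq d 0.
  exists g, w, q, p; split=> // k; rewrite inE => /orP[/eqP->|/dvs //].
  by exists 0; rewrite -/a aE' bd cd d0 !mulr0 !scale0r addr0 scaler0.
have : x * g' + y * b' + z * c' = 1.
  by apply: (mulIf d0); rewrite mul1r -[RHS]lin gd bd cd; ring.
move=> {x y z lin} /(adequate_comax hbez hgood)[x [y [s' [t E]]]].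
set pa1 := (p *m a1) 0 0; set ra1 := (r *m a1) 0 0; set rw := (r *m w) 0 0.
have pa1E : p *m a1 = pa1%:M by rewrite [LHS]mx11_scalar.
have ra1E : r *m a1 = ra1%:M by rewrite [LHS]mx11_scalar.
have rwE : r *m w = rw%:M by rewrite [LHS]mx11_scalar.
(* Cancelling [d] in p (c a1) = 0 gives [c1], and in r (c a1) = c gives [c2]. *)
have c1 : c' * pa1 = 0.
  apply: (mulIf d0); rewrite mul0r mulrAC -cd.
  have /(congr1 (fun M : 'M_1 => M 0 0)) := congr1 (mulmx p) aE.
  by rewrite mulmxBr -!scalemxAr pw pa pa1E !mxE mulr1 subrr => <-.
have c2 : c' * ra1 = c'.
  apply: (mulIf d0); rewrite mulrAC -cd.
  have /(congr1 (fun M : 'M_1 => M 0 0)) := rE.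
  by rewrite aE -scalemxAr ra1E !mxE.
exists d, ((x * g' + y * b') *: w + (y * c') *: a1), (x *: q + y *:
  delta_mx j 0).
(* The row r - rw p kills [w] and, by [c1] and [c2], sends c' a1 to c'. Hence the new row sends the
   new column to s' (x g' + y b') + t y c' = 1. *)
exists (s' *: p + t *: (r - rw *: p)); split.
- rewrite mulmxDr -!scalemxAr Aq -colE -/a aE' bd cd gd.
  by rewrite !scalerDr !scalerA addrA -scalerDl; congr (_ *: _ + _ *: _); ring.
- rewrite mulmxDl -!scalemxAl mulmxBl -scalemxAl !mulmxDr -!scalemxAr pw pa1E
  ra1E rwE.
  rewrite !(scale_scalar_mx, =^~ raddfD, =^~ raddfB); congr (_%:M).
  rewrite -[RHS]E /= -[in RHS]c2; apply/eqP; rewrite -subr_eq0; apply/eqP.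
  by transitivity ((s' - t * rw) * y * (c' * pa1)); [ring | rewrite c1 mulr0].
- move=> k; rewrite inE => /orP[/eqP->|/dvs[v ->]]; last first.
    by exists (g' *: v); rewrite scalerA gd mulrC.
  exists (b' *: w + c' *: a1); rewrite -/a aE' scalerDr !scalerA bd cd.
  by congr (_ *: _ + _ *: _); ring.
Qed.

(** Once all columns are treated, A = g A1 and A q = g w. As [g] is nonzero it cancels, so A1 q = w
    and p A1 q = p w = 1. *)
Lemma corner m n (A : 'M[B]_(m, n)) : A != 0 ->
  exists g A1 (p : 'rV_m) (q : 'cV_n), A = g *: A1 /\ p *m A1 *m q = 1%:M.
Proof.
case: m A => [|m] A A0; first by rewrite flatmx0 eqxx in A0.
have [g [w [q [p [Aq pw dv]]]]] := unimodular_column_span A (enum 'I_n).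
have /choice[v vE] : forall j, exists v, col j A = g *: v.
  by move=> j; apply: dv; rewrite mem_enum.
exists g, (\matrix_(i, j) v j i 0), p, q.
have AE : A = g *: (\matrix_(i, j) v j i 0).
  by apply/matrixP=> i j; move/colP/(_ i): (vE j); rewrite !mxE.
split=> //; have g0 : g != 0.
  by apply: contraNneq A0 => g0; rewrite AE g0 scale0r.
suff /(congr1 (mulmx p)) : (\matrix_(i, j) v j i 0) *m q = w by
  rewrite mulmxA pw.
have /matrixP gqw : g *: (\matrix_(i, j) v j i 0 *m q) = g *: w.
  by rewrite scalemxAl -AE.
by apply/matrixP=> i j; have := gqw i j; rewrite mxE [X in _ = X -> _]mxE =>
  /(mulfI g0).
Qed.

End Corner.

(** * Matrices over the ring acting on tuples of module elements *)

Section MatrixAction.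
Variables (B : idomainType) (M : lmodType B).

(** The entries of [x] lie in a module and not in the ring, so the product [*m] does not apply to
    them. *)
Definition mact m n (A : 'M[B]_(m, n)) (x : 'I_n -> M) (i : 'I_m) : M :=
  \sum_j A i j *: x j.

Lemma mactM m n k (A : 'M_(m, n)) (C : 'M_(n, k)) x :
  mact (A *m C) x =1 mact A (mact C x).
Proof.
move=> i; rewrite /mact; under eq_bigr do rewrite mxE scaler_suml.
rewrite exchange_big; apply: eq_bigr => j _; rewrite scaler_sumr.
by apply: eq_bigr => l _; rewrite scalerA.
Qed.

Lemma eq_mact m n (A : 'M_(m, n)) x y : x =1 y -> mact A x =1 mact A y.
Proof. by move=> xy i; apply: eq_bigr => j _; rewrite xy. Qed.

Lemma mactBl m n (A C : 'M_(m, n)) x i :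
  mact (A - C) x i = mact A x i - mact C x i.
Proof. by rewrite -sumrB; apply: eq_bigr => j _; rewrite !mxE scalerBl. Qed.

Lemma mactZl m n c (A : 'M_(m, n)) x i : mact (c *: A) x i = c *: mact A x i.
Proof. by rewrite scaler_sumr; apply: eq_bigr => j _; rewrite !mxE scalerA. Qed.

Lemma mactDr m n (A : 'M_(m, n)) x y i :
  mact A (fun j => x j + y j) i = mact A x i + mact A y i.
Proof. by rewrite -big_split; apply: eq_bigr => j _; rewrite scalerDr. Qed.

Lemma mactZr m n c (A : 'M_(m, n)) x i :
  mact A (fun j => c *: x j) i = c *: mact A x i.
Proof.
by rewrite scaler_sumr; apply: eq_bigr => j _; rewrite !scalerA mulrC.
Qed.

Lemma mact_delta m n (i : 'I_m) (j : 'I_n) x : mact (delta_mx i j) x i = x j.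
Proof.
rewrite /mact (bigD1 j) //= mxE !eqxx scale1r big1 ?addr0 // => k /negPf kj.
by rewrite mxE kj andbF scale0r.
Qed.

Lemma mact0l m n x i : mact (0 : 'M_(m, n)) x i = 0.
Proof. by apply: big1 => j _; rewrite mxE scale0r. Qed.

Lemma mact_row m n1 n2 (A : 'M_(m, n1)) (C : 'M_(m, n2)) x y i :
  mact (row_mx A C)
    (fun l => match split l with inl j => x j | inr j => y j end) i =
  mact A x i + mact C y i.
Proof.
rewrite /mact big_split_ord /=; congr (_ + _); apply: eq_bigr => j _.
  by rewrite row_mxEl (unsplitK (inl _ j)).
by rewrite row_mxEr (unsplitK (inr _ j)).
Qed.

Lemma mact1 n (x : 'I_n -> M) : mact 1%:M x =1 x.
Proof.
move=> i; rewrite /mact (bigD1 i) //= mxE eqxx scale1r big1 ?addr0 // => k.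
by rewrite mxE eq_sym => /negPf ->; rewrite scale0r.
Qed.

End MatrixAction.

(** * Solvability of linear systems as divisibility conditions *)

Section LinearSystems.
Variable B : idomainType.
Hypotheses (hbez : bezout B) (hgood : good_factorization B).

(** Induction on the rank over the fraction field. The list [s] depends on [A] alone, so one
    criterion serves all modules and right-hand sides. *)
Lemma linear_system_solvable m n (A : 'M[B]_(m, n)) :
  exists s : seq (B * 'rV_m), forall (M : lmodType B) (t : 'I_m -> M),
    (exists x, mact A x =1 t) <->
    forall gp, gp \in s -> exists z, mact gp.2 t 0 = gp.1 *: z.
Proof.
have [r] := ubnP (\rank (map_mx (@FracField.tofrac B) A)).
elim: r A => // r IHr A; have [-> _|A0 rA] := eqVneq A 0.
  (* A zero matrix forces t = 0, expressed as divisibility of each entry by 0. *)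
  exists [seq (0, delta_mx 0 i) | i <- enum 'I_m] => M t.
  split=> [[x xt] _ /mapP[i _ ->]|t0].
    by exists 0; rewrite /= mact_delta scale0r -xt mact0l.
  exists (fun=> 0) => i; rewrite mact0l.
  have [|z] := t0 (0, delta_mx 0 i); first by apply/map_f/mem_enum.
  by rewrite /= mact_delta scale0r.
have [g [A1 [p [q [AE pAq]]]]] := corner hbez hgood A0.
(* Since p A1 q = 1, the matrix A1 q p is idempotent; [N] is the complementary projection and kills
   A q = g A1 q. *)
pose N := 1%:M - A1 *m q *m p; pose A' := N *m A.
have A'q : A' *m q = 0.
  rewrite /A' /N mulmxBl mul1mx AE -!scalemxAr -scalerBr -scalemxAl mulmxBl.
  by rewrite -!mulmxA [p *m _]mulmxA pAq mulmx1 subrr scaler0.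
have Aq0 : A *m q != 0.
  apply: contraNneq A0 => Aq0; have : p *m (A *m q) = 0 by rewrite Aq0 mulmx0.
  rewrite mulmxA {1}AE -scalemxAr -scalemxAl pAq => /matrixP/(_ 0 0).
  by rewrite !mxE mulr1 AE => ->; rewrite scale0r.
(* The row space of A' = N A lies in that of [A], strictly: A = D A' over the fraction field would
   give A q = 0. *)
have [|s sP] := IHr A'.
  apply: leq_trans (rank_ltmx _) _; last by rewrite ltnS in rA; exact: rA.
  apply/andP; split; first by rewrite map_mxM submxMl.
  apply: contra Aq0 => /submxP[D DE].
  have /matrixP Aq0 : map_mx (@FracField.tofrac B) (A *m q) = 0.
    by rewrite map_mxM DE -mulmxA -map_mxM A'q map_mx0 mulmx0.
  apply/eqP/matrixP => i j; have /eqP := Aq0 i j.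
  by rewrite mxE [X in _ == X -> _]mxE tofrac_eq0 => /eqP ->; rewrite mxE.
exists ((g, p) :: [seq (h.1, h.2 *m N) | h <- s]) => M t.
have A'E : A' = A - A *m q *m p *m A1.
  by rewrite /A' /N mulmxBl mul1mx AE -!scalemxAl -!scalemxAr.
split=> [[x xt]|tP].
  have /sP solA' : exists x', mact A' x' =1 mact N t.
    by exists x => i; rewrite mactM; apply: eq_mact.
  move=> gp; rewrite inE => /orP[/eqP->|/mapP[h /solA'[z hz] ->]] /=.
    exists (mact p (mact A1 x) 0); rewrite -(eq_mact _ xt) -mactZr.
    by apply: eq_mact => i; rewrite AE mactZl.
  by exists z; rewrite mactM.
have [|xi xiE] := tP (g, p); first by rewrite inE eqxx.
have [|x xE] := (sP M (mact N t)).2.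
  move=> h hs; have [|z] := tP (h.1, h.2 *m N).
    by rewrite inE; apply/orP; right; apply/mapP; exists h.
  by rewrite /= mactM => ->; exists z.
(* With p t = g xi and A' x = N t, applying [A] to q xi + (1 - q p A1) x gives A1 q (g xi) + A' x =
   A1 q p t + N t = t. *)
exists (fun j => mact q (fun=> xi) j + mact (1%:M - q *m p *m A1) x j) => i.
rewrite mactDr -!mactM mulmxBr mulmx1 !mulmxA -A'E xE mactBl mact1.
rewrite AE -scalemxAl mactZl -mactZr mactM [in X in _ + (_ - X)]mactM.
rewrite addrC -addrA -[X in _ = X]addr0; congr (_ + _).
rewrite -[X in _ + X]mactM (_ :
  mact _ (mact p t) i = mact (A1 *m q) (fun=> g *: xi) i) ?addNr //.
by apply: eq_mact => k; rewrite ord1 xiE.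
Qed.

End LinearSystems.

(** * Divisibility in a module and in its localizations *)

Section Localization.
Variables (B : idomainType) (M : lmodType B).

Lemma tolocD (P : MSpec B) : {morph @toloc B M P : x y / x + y}.
Proof.
move=> x y; rewrite /toloc mfracD; apply: eq_mfrac => /=.
by rewrite !scale1r mulr1 scale1r.
Qed.

Lemma tolocZ (P : MSpec B) b (x : M) :
  toloc P (b *: x) = rfrac b (denom1 P) *: toloc P x.
Proof. by rewrite /toloc mfracZ; apply: eq_mfrac; rewrite /= mulr1. Qed.

Lemma toloc_sum (P : MSpec B) n (c : 'I_n -> B) (u : 'I_n -> M) :
  toloc P (\sum_j c j *: u j) = \sum_j rfrac (c j) (denom1 P) *: toloc P (u j).
Proof.
rewrite (big_morph _ (@tolocD P) (erefl : toloc P 0 = 0)).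
by apply: eq_bigr => j _; rewrite tolocZ.
Qed.

(** The b with b m in g M form an ideal. Divisibility at P puts into it an element outside P, so no
    maximal ideal contains it and it contains 1. *)
Lemma divisible_local_global (g : B) (m : M) :
  (exists z, m = g *: z) <->
  forall P : MSpec B, exists z : locmod M P, toloc P m = rfrac g (denom1 P) *:
    z.
Proof.
split=> [[z ->] P|locm]; first by exists (toloc P z); rewrite tolocZ.
pose J : set B := [set b | exists z, b *: m = g *: z].
apply: contrapT => ndiv; have [|P JP] := @krull B J.
  split; [| |move=> a x y]; rewrite ?inE.
  - by exists 0; rewrite scale0r scaler0.
  - by apply/negP; rewrite inE => -[z]; rewrite scale1r => mE; apply: ndiv;
    exists z.
  - move=> [z xz] [w yw]; exists (a *: z + w).
    by rewrite scalerDl -scalerA xz yw scalerDr !scalerA mulrC.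
have [z] := locm P; elim/mfracW: z => z s; rewrite mfracZ => /mfrac_eq[u /=].
rewrite mul1r scale1r !scalerA [_ * g]mulrC -[in RHS]scalerA => E.
have /JP/mset_prime[] : J (dval u * dval s) by exists (dval u *: z).
  exact: denomP.
exact: denomP.
Qed.

(** Units of B remain units in the localization, so the units in the coset of [g] are absorbed. *)
Lemma gset_gloc_vB (P : MSpec B) (g : B) (g0 : g != 0) :
  gset (gloc P (vB g0)) = gcoset (locval P) g%:F.
Proof.
rewrite eqEsubset; split=> x /=.
  move=> [_ [_ [r [s rs] <-] <-] [_ [y [z yz] <-] <-]].
  exists (locval P (rfrac r (denom1 P) * y)); last first.
    by rewrite rmorphM /= rmorph1 divr1 mulrA.
  exists (rfrac r (denom1 P) * y) => //; exists (rfrac s (denom1 P) * z).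
  rewrite mulrACA yz mulr1 rfracM rs -rfrac1; apply/rfrac_eq => /=; ring.
by move=> [u Uu <-]; exists g%:F; [exact: gcoset_refl | exists u].
Qed.

Lemma lrval_rfrac1 (P : MSpec B) (b : B) : lrval (rfrac b (denom1 P)) = b%:F.
Proof. by rewrite /= rmorph1 divr1. Qed.

Section AtomsOver.
Variables (O : set (MSpec B)) (n : nat).

Lemma scal_const_subproof (b : B) (P : MSpec B) : O P -> b%:F \in locset P.
Proof. by move=> _; rewrite -(lrval_rfrac1 P); exact: lrvalP. Qed.
Definition scal_const (b : B) : scal_over O :=
  exist _ b%:F (scal_const_subproof b).

Lemma scal_constE b (P : MSpec B) (OP : O P) :
  scal_at OP (scal_const b) = rfrac b (denom1 P).
Proof. by apply: val_inj; rewrite [RHS]lrval_rfrac1. Qed.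

Lemma gamma_const_subproof (g : B) (g0 : g != 0) (P : MSpec B) :
  O P -> gpositive (gloc P (vB g0)).
Proof.
move=> _; exists (rfrac g (denom1 P)); rewrite [locval P _]lrval_rfrac1.
  exact: tofrac_neq0.
exact: gset_gloc_vB.
Qed.
Definition gamma_const (g : B) (g0 : g != 0) : gamma_over O :=
  exist _ (vB g0 : Gamma B) (gamma_const_subproof g0).

Lemma Vcan_gamma_const g (g0 : g != 0) (P : MSpec B) (OP : O P) (x :
  locmod M P) :
  Vcan (gamma_at OP (gamma_const g0)) x <->
  exists z : locmod M P, x = rfrac g (denom1 P) *: z.
Proof.
split=> [[a [a0 aE [m ->]]]|[z ->]]; last first.
  exists (rfrac g (denom1 P)); rewrite [locval P _]lrval_rfrac1.
  split; [exact: tofrac_neq0|exact: gset_gloc_vB|by exists z].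
(* [a] is another generator of the value of [g], hence [g] times a unit of the localization. *)
have : gcoset (locval P) g%:F (locval P a).
  by rewrite -(gset_gloc_vB _ g0) aE; exact: gcoset_refl.
move=> [_ [r _ <-] E]; exists (r *: m); rewrite scalerA; congr (_ *: _).
by apply: val_inj; rewrite [LHS](esym E) rmorphM /= rmorph1 divr1.
Qed.

Definition linear_term (c : 'rV[B]_n) : term (scal_over O) 'I_n :=
  foldr (fun j t => Tadd (Tscale (scal_const (c 0 j)) (Tvar _ j)) t) Tzero
        (enum 'I_n).

Lemma eval_linear_term c (P : MSpec B) (OP : O P) (e : 'I_n -> locmod M P) :
  eval e (map_term (scal_at OP) (linear_term c)) =
  \sum_j rfrac (c 0 j) (denom1 P) *: e j.
Proof.
rewrite -big_enum /linear_term /=; elim: (enum 'I_n) => [|j s IHs] /=.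
  by rewrite big_nil.
by rewrite big_cons -IHs scal_constE.
Qed.

(* The predicate V_{v(g)} only exists for g != 0; divisibility by 0 is the
   equation t = 0. *)
Definition divisibility_atom (g : B) (c : 'rV[B]_n) :
    atom (scal_over O) (gamma_over O) 'I_n :=
  match @idP (g != 0) with
  | ReflectT g0 => Apred (gamma_const g0) (linear_term c)
  | ReflectF _ => Aeq _ (linear_term c) Tzero
  end.

Lemma sat_divisibility_atom g c (P : MSpec B) (OP : O P) (u : 'I_n -> M) :
  sat_atom (@Vcan _ _ (locval P) (locmod M P)) (fun j => toloc P (u j))
    (map_atom (scal_at OP) (gamma_at OP) (divisibility_atom g c)) <->
  exists z : locmod M P, toloc P (mact c u 0) = rfrac g (denom1 P) *: z.
Proof.
rewrite /mact toloc_sum /divisibility_atom; case: {-}_ / idP => [g0|/negP] /=.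
  by rewrite eval_linear_term; exact: Vcan_gamma_const.
(* Here [g] = 0, whose only multiple is 0, in agreement with the equation. *)
rewrite negbK eval_linear_term => /eqP ->.
have -> : rfrac 0 (denom1 P) = 0 by apply: val_inj;
  rewrite [LHS]lrval_rfrac1 !rmorph0.
by split=> [->|[z ->]]; [exists 0; rewrite scaler0 | rewrite scale0r].
Qed.

End AtomsOver.

End Localization.

(** * From pp formulas to linear systems *)

Section Formulas.
Variables (B : idomainType) (M : lmodType B).

Lemma eval_linear (X : finType) (t : term B X) :
  exists c : X -> B, forall e : X -> M, eval e t = \sum_x c x *: e x.
Proof.
elim: t => [x||t1 [c1 E1] t2 [c2 E2]|t [c E]|a t [c E]] /=.
- exists (fun y => (y == x)%:R) => e;
  rewrite (bigD1 x) //= eqxx scale1r big1 ?addr0 //.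
  by move=> y /negPf ->; rewrite scale0r.
- by exists (fun=> 0) => e; rewrite big1 // => x _; rewrite scale0r.
- exists (fun x => c1 x + c2 x) => e; rewrite E1 E2 -big_split.
  by apply: eq_bigr => x _; rewrite scalerDl.
- exists (fun x => - c x) => e; rewrite E -sumrN.
  by apply: eq_bigr => x _; rewrite scaleNr.
- exists (fun x => a * c x) => e; rewrite E scaler_sumr.
  by apply: eq_bigr => x _; rewrite scalerA.
Qed.

Lemma sat_map (R : pzRingType) (N : lmodType R) (D X : Type) (V : D -> set N)
    (e : X -> N) (T : eqType) (f : T -> atom R D X) (s : seq T) :
  sat V e (map f s) <-> forall h, h \in s -> sat_atom V e (f h).
Proof.
elim: s => [|h s IHs] /=; first by split=> // _ h; rewrite in_nil.
split=> [[sh /IHs ss] k|ss]; first by rewrite inE => /orP[/eqP->|/ss].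
split; first by apply: ss; rewrite mem_head.
by apply/IHs => k ks; apply: ss; rewrite inE ks orbT.
Qed.

(** Conjuncts are addressed by position, since membership in a list of atoms would need an equality
    test on atoms. *)
Lemma sat_tnth (R : pzRingType) (N : lmodType R) (D X : Type) (V : D -> set N)
    (e : X -> N) (th : conj_atoms R D X) :
  sat V e th <-> forall i, sat_atom V e (tnth (in_tuple th) i).
Proof.
rewrite -{1}(map_tnth_enum (in_tuple th) : _ = th) sat_map.
by split=> sth i; [apply: sth; rewrite mem_enum|].
Qed.

Variables (V : GammaPos B -> set M).
Hypothesis hV : model_TVdiv V.

(** An equation says that 0 divides a difference of linear forms; a predicate says that a generator
    of its index divides one, by [model_TVdivP]. *)
Lemma atom_divisibility (X : finType) (A : atom B (GammaPos B) X) :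
  exists (g : B) (c : X -> B), forall e : X -> M,
    sat_atom V e A <-> exists z, \sum_x c x *: e x = g *: z.
Proof.
case: A => [t1 t2|d t] /=.
  have [c1 E1] := eval_linear t1; have [c2 E2] := eval_linear t2.
  exists 0, (fun x => c1 x - c2 x) => e; under eq_bigr do rewrite scalerBl.
  rewrite sumrB -E1 -E2; split=> [->|[z /eqP]].
    by exists 0; rewrite subrr scaler0.
  by rewrite scale0r subr_eq0 => /eqP.
have [c E] := eval_linear t; have [g [g0 ->]] := gpos_vB d.
exists g, c => e; rewrite -E; exact: (model_TVdivP V).1.
Qed.

(** Each atom i brings a further unknown z_i for its quotient. The conditions c_i(x, u) = g_i z_i,
    with u moved to the right, are a linear system in (x, z). *)
Lemma pp_linear_system n (phi : pp_formula B (GammaPos B) n) :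
  exists m k (A : 'M[B]_(m, k)) (C : 'M_(m, n)), forall u : 'I_n -> M,
    sat_pp V u phi <-> exists x, mact A x =1 mact C u.
Proof.
case: phi => k th; set m := size th.
have /choice[g /choice[c gcE]] i := atom_divisibility (tnth (in_tuple th) i).
pose Cx := \matrix_(i, j) c i (inl j); pose Cu := \matrix_(i, j) c i (inr j).
pose G := \matrix_(i, j) (g i *+ (i == j)).
(* The unknowns are the [k] bound variables followed by the [m] quotients. Writing [0 - G] and
   [0 - Cu] lets [mactBl] and [mact0l] handle the signs. *)
exists m, (k + m)%N, (row_mx Cx (0 - G)), (0 - Cu) => u.
have GE z i : mact G z i = g i *: z i.
  rewrite /mact (bigD1 i) //= mxE eqxx mulr1n big1 ?addr0 // => j.
  by rewrite mxE eq_sym => /negPf ->; rewrite mulr0n scale0r.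
have systemE x z i : mact (row_mx Cx (0 - G)) (fun l => match split l with
    inl j => x j | inr j => z j end) i = mact (0 - Cu) u i <->
    \sum_y c i y *: (match y with inl j => x j | inr j => u j end) = g i *: z i.
  rewrite mact_row !mactBl !mact0l GE !sub0r big_sumType /=.
  rewrite [X in X + _ = _ <-> _](_ : mact Cx x i = \sum_j c i (inl j) *: x j);
    last first.
    by apply: eq_bigr => j _; rewrite mxE.
  rewrite (_ : mact Cu u i = \sum_j c i (inr j) *: u j); last first.
    by apply: eq_bigr => j _; rewrite mxE.
  by split=> /eqP E; apply/eqP; move: E;
    rewrite subr_eq [- _ + _]addrC -subr_eq opprK.
split=> [[x /sat_tnth/= sx]|[x xE]].
  have /choice[z zE] i := (gcE i _).1 (sx i).
  by exists (fun l => match split l with inl j => x j | inr j => z j end) => i;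
    apply/systemE.
exists (fun j => x (lshift m j)); apply/sat_tnth => i; apply/gcE.
exists (x (rshift k i)); apply/(systemE _ (fun j => x (rshift k j))).
by rewrite -xE; apply: eq_mact => l; case: split_ordP => j ->.
Qed.

End Formulas.

Theorem corollary5p7 (B : idomainType) (hbez : bezout B)
    (hgood : good_factorization B)
    (M : lmodType B) (V : GammaPos B -> set M) (hV : model_TVdiv V)
    (n : nat) (phi : pp_formula B (GammaPos B) n) :
  exists (I : finType) (O : I -> set (MSpec B))
         (theta : forall i : I, conj_over (O i) n),
    [/\ partition [set: I] O [set: MSpec B],
        forall i : I, basic_open (O i) \/ basic_closed (O i) &
        forall u : 'I_n -> M,
          sat_pp V u phi <->
          forall (i : I) (P : MSpec B) (hP : O i P),
            sat (@Vcan _ _ (locval P) (locmod M P))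
                (fun j => toloc P (u j)) (formula_at hP (theta i))].
Proof.
have [m [k [A [C phiE]]]] := pp_linear_system hV phi.
have [s sE] := linear_system_solvable hbez hgood A.
(* The right-hand side is t = C u, so a condition on h.2 t becomes one on the linear form h.2 C in
   u. *)
exists unit, (fun=> setT), (fun=> [seq divisibility_atom setT h.1 (h.2 *m C) |
  h <- s]).
split.
- split; [by rewrite /cover bigcup_const //; exists tt|by move=> [] []|].
  (* The block of a partition must be nonempty: some maximal ideal lies above the zero ideal. *)
  move=> _ _; have [|P _] := @krull B [set 0]; last by exists P.
  split; [by rewrite inE|by apply/negP; rewrite inE => /eqP; rewrite oner_eq0|].
  by move=> a x y; rewrite !inE => -> ->; rewrite mulr0 addr0.
- by move=> _; right; exists 0; apply/esym/seteqP; split=> // P _; exact: mset0.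
move=> u; rewrite phiE sE; split=> [div _ P hP|satP h hs].
  rewrite /formula_at /map_conj -map_comp; apply/sat_map => h /div.
  by rewrite -mactM => /divisible_local_global/(_ P); apply:
    (sat_divisibility_atom _ _ hP u).2.
rewrite -mactM; apply/divisible_local_global => P.
have := satP tt P I; rewrite /formula_at /map_conj -map_comp =>
  /sat_map/(_ h hs).
by move=> /sat_divisibility_atom.
Qed.
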